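(* Consider the choice-based network revenue management problem with Markovian-correlated customer arrivals described in the context, and suppose the substitutability assumption holds: for every $s\in\mathcal S$, every $A\in\mathcal F$, every product $j\in A$ and product $j'\notin A$, $\phi_j(A,s)\ge \phi_j(A\cup\{j'\},s)$; and if $A\in\mathcal F$ then every subset $B\subseteq A$ belongs to $\mathcal F$. Let $L=\max_{j\in[n]}\sum_{i\in[m]}a_{i,j}$, let $\mathsf{ALG}$ be the expected total reward of the Assortment Bid Price Policy (Algorithm 2, described in the context) and $\mathsf{OPT}$ the expected total reward of an optimal online policy. Then \[ \mathsf{ALG}\ge \frac{1}{1+L}\cdot\mathsf{OPT}. \]
   Context: There are $m$ resources with initial capacities $C_i>0$, and products $j\in[n]$ with reward $r_j$ and consumption vector $\bm a_j\in\{0,1\}^m$ ($a_{i,j}$ its $i$-th entry); a null product $0$ with $r_0=0$, $\bm a_0=\bm 0$ represents no purchase and is always implicitly included in any offered assortment. Let $\mathcal A_j=\{i:a_{i,j}=1\}$, $\mathcal B_i=\{j\in[n]:a_{i,j}=1\}$. $\mathcal F$ is a given collection of feasible assortments (subsets of products), containing the empty assortment. There is a finite state space $\mathcal S$; states $s_1,\dots,s_T$ form a time-inhomogeneous Markov chain with $P(s_1=s)=p_1(s)$, $P(s_{t+1}=s'\mid s_t=s)=p_t(s,s')$. At period $t$, after $s_t$ is revealed, the decision maker offers an assortment $A_t\in\mathcal F$ such that the remaining capacity $\bm c_t\ge \bm a_j$ for every $j\in A_t$; customer $t$ then chooses product $j\in A_t\cup\{0\}$ with probability $\phi_j(A_t,s_t)$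 (given numbers with $\sum_{j}\phi_j(A,s)=1$), independently of everything else given $A_t,s_t$; choosing $j$ consumes $\bm a_j$ and earns $r_j$. Decisions may depend only on the instance and past/current realizations. An optimal online policy maximizes expected total reward. Bid prices: $\nu^{T+1}_j(s)=0$; for $t=T,\dots,1$, define $g_t(j,s)=\big[r_j-\sum_{s'}p_t(s,s')\sum_{i\in\mathcal A_j}\frac{1}{C_i}\sum_{j'\in\mathcal B_i}\nu^{t+1}_{j'}(s')\big]^+$, let $\hat A_t(s)\in\arg\max_{A\in\mathcal F}\sum_{j\in A}\phi_j(A,s)g_t(j,s)$, and set \[ \nu^t_j(s)=\sum_{s'}p_t(s,s')\nu^{t+1}_j(s')+\mathbb 1_{\{j\in\hat A_t(s)\}}\,\phi_j(\hat A_t(s),s)\,g_t(j,s). \] Algorithm 2: at each period $t$, observe $s_t$ and $\bm c_t$, and offer $A_t(s_t)=\{j\in\hat A_t(s_t):\bm c_t\ge\bm a_j\}$.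
   Formalization: Capacities C_i are taken to be positive integers, and the maximizer Â_t(s) is required to contain no product whose reward r_j is below its bid price; with fractional capacities or arbitrary tie-breaking in the argmax the bound fails. *)

(* Defs.v *)
(* MathComp, with the reals and classical sets of MathComp-Analysis. *)
From mathcomp Require Import all_boot all_order all_algebra.
From mathcomp Require Import boolp classical_sets reals.

Set Implicit Arguments.
Unset Strict Implicit.
Unset Printing Implicit Defensive.

Import Order.TTheory GRing.Theory Num.Theory.

Local Open Scope ring_scope.

(* Products are ['I_n]; in [option 'I_n], [None] is the null product.
   Periods are numbered 1, ..., T.  Capacities are whole units. *)
Record instance (R : realType) (m n : nat) (S : finType) := Instance {
  horizon : nat;
  cap : 'I_m -> nat;
  rew : 'I_n -> R;
  uses : 'I_m -> 'I_n -> bool;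
  feasible : {set {set 'I_n}};
  init : S -> R;
  trans : nat -> S -> S -> R;
  phi : option 'I_n -> {set 'I_n} -> S -> R }.

Section Model.
Variables (R : realType) (m n : nat) (S : finType) (I : instance R m n S).

Local Notation T := (horizon I).

(* [phi j A s] is constrained only where it is meaningful: A feasible and
   j in A or j null.  Likewise [trans t] only for 1 <= t < T. *)
Record well_formed : Prop := WellFormed {
  cap_gt0 : forall i, (0 < cap I i)%N;
  feasible0 : finset.set0 \in feasible I;
  init_ge0 : forall s, 0 <= init I s;
  init_sum1 : \sum_s init I s = 1;
  trans_ge0 : forall t s s', (0 < t < T)%N -> 0 <= trans I t s s';
  trans_sum1 : forall t s, (0 < t < T)%N -> \sum_s' trans I t s s' = 1;
  phi_null_ge0 : forall A s, A \in feasible I -> 0 <= phi I None A s;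
  phi_ge0 : forall j A s, A \in feasible I -> j \in A ->
    0 <= phi I (Some j) A s;
  phi_sum1 : forall A s, A \in feasible I ->
    phi I None A s + \sum_(j in A) phi I (Some j) A s = 1 }.

Definition substitutable : Prop :=
  (forall s (A : {set 'I_n}) j j',
     A \in feasible I -> j \in A -> j' \notin A ->
     phi I (Some j) A s >= phi I (Some j) (j' |: A)%SET s) /\
  (forall A B : {set 'I_n},
     A \in feasible I -> B \subset A -> B \in feasible I).

Definition max_use : nat := \max_(j < n) \sum_(i < m) uses I i j.

(* The realizations (state, chosen product) of periods 1, ..., t, in
   chronological order. *)
Definition history := seq (S * option 'I_n).

(* A policy maps the history of the past periods and the current state to the
   assortment offered. *)
Definition policy := history -> S -> {set 'I_n}.

Definition consumption (i : 'I_m) (j : option 'I_n) : nat :=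
  if j is Some j then uses I i j else 0%N.

Definition reward (j : option 'I_n) : R := if j is Some j then rew I j else 0.

(* The subtraction truncates only on histories that overuse a resource; these
   have probability 0 under every feasible policy. *)
Definition remaining (h : history) (i : 'I_m) : nat :=
  (cap I i - \sum_(x <- h) consumption i x.2)%N.

Definition available (h : history) (j : 'I_n) : bool :=
  [forall i, (uses I i j <= remaining h i)%N].

Definition feasible_policy (pi : policy) : Prop :=
  forall h s, pi h s \in feasible I /\ forall j, j \in pi h s -> available h j.

Definition state_prob (h : history) (s : S) : R :=
  if h is x :: h' then trans I (size h) (last x h').1 s else init I s.

Definition choice_prob (A : {set 'I_n}) (s : S) (j : option 'I_n) : R :=
  if j is Some k then if k \in A then phi I j A s else 0 else phi I None A s.

Definition traj_prob (pi : policy) (w : T.-tuple (S * option 'I_n)) : R :=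
  \prod_(t < T)
    let h := take t w in let x := tnth w t in
    state_prob h x.1 * choice_prob (pi h x.1) x.1 x.2.

Definition expected_reward (pi : policy) : R :=
  \sum_(w : T.-tuple (S * option 'I_n))
    traj_prob pi w * \sum_(t < T) reward (tnth w t).2.

Definition OPT : R :=
  sup [set expected_reward pi | pi in [set pi | feasible_policy pi]]%classic.

Lemma OPT_attained : well_formed ->
  exists pi, [/\ feasible_policy pi, expected_reward pi = OPT &
    forall pi', feasible_policy pi' -> expected_reward pi' <= expected_reward pi].
Proof.
move=> wfI; pose H := T.-bseq (S * option 'I_n)%type.
pose ext (f : {ffun H * S -> {set 'I_n}}) : policy := fun h s =>
  if (insub h : option H) is Some b then f (b, s) else finset.set0.
pose res (pi : policy) : {ffun H * S -> {set 'I_n}} :=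
  [ffun u => pi (val u.1) u.2].
have ext_res pi : feasible_policy pi -> feasible_policy (ext (res pi)).
  move=> Fpi h s; rewrite /ext; case: insubP => [b _ <-|_]; first by rewrite ffunE.
  by split=> [|j]; [exact: feasible0 | rewrite inE].
have val_res pi : expected_reward (ext (res pi)) = expected_reward pi.
  apply: eq_bigr => w _; congr (_ * _); apply: eq_bigr => t _ /=.
  suff -> : ext (res pi) (take t w) (tnth w t).1 = pi (take t w) (tnth w t).1 by [].
  have le_T : (size (take t w) <= T)%N.
    by rewrite size_take size_tuple ltn_ord ltnW.
  by rewrite /ext insubT ffunE.
pose P f := `[< feasible_policy (ext f) >].
have P0 : P (res (fun _ _ => finset.set0)).
  apply/asboolP/ext_res => h s; split=> [|j]; last by rewrite inE.
  exact: feasible0.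
have [f /asboolP Pf maxf] := arg_maxP (fun f => expected_reward (ext f)) P0.
have max_pi pi' : feasible_policy pi' -> expected_reward pi' <= expected_reward (ext f).
  by move=> Fpi'; rewrite -val_res; apply: maxf; apply/asboolP/ext_res.
exists (ext f); split=> //; apply/eqP; rewrite eq_le; apply/andP; split.
  apply: ub_le_sup; last by exists (ext f).
  by exists (expected_reward (ext f)) => _ [pi' Fpi' <-]; apply: max_pi.
apply: ge_sup; first by exists (expected_reward (ext f)), (ext f).
by move=> _ [pi' Fpi' <-]; apply: max_pi.
Qed.

Definition bid_cost (nu : nat -> 'I_n -> S -> R) (t : nat) (j : 'I_n) (s : S)
    : R :=
  \sum_s' trans I t s s' *
    \sum_(i | uses I i j) (cap I i)%:R^-1 * \sum_(j' | uses I i j') nu t.+1 j' s'.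

Definition gain nu t j s : R := Num.max (rew I j - bid_cost nu t j s) 0.

Definition gain_value nu t s (A : {set 'I_n}) : R :=
  \sum_(j in A) phi I (Some j) A s * gain nu t j s.

(* The last clause restricts the choice among maximizers to those containing
   no product priced below its bid price.  Such a product has gain 0, so under
   substitutability it can be removed without losing optimality, but some
   maximizers do contain one, and following them can make the policy
   arbitrarily bad: with one unit of capacity, two periods, and two products of
   rewards 0 and 1 that can only be offered separately and then sell surely,
   all gains vanish in period 1, so offering the worthless product maximizes. *)
Record bid_prices (nu : nat -> 'I_n -> S -> R) (Ahat : nat -> S -> {set 'I_n})
    : Prop := BidPrices {
  nu_end : forall j s, nu T.+1 j s = 0;
  nu_step : forall t j s, (0 < t <= T)%N ->
    nu t j s = \sum_s' trans I t s s' * nu t.+1 j s' +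
      (if j \in Ahat t s then phi I (Some j) (Ahat t s) s * gain nu t j s
       else 0);
  Ahat_feasible : forall t s, (0 < t <= T)%N -> Ahat t s \in feasible I;
  Ahat_max : forall t s A, (0 < t <= T)%N -> A \in feasible I ->
    gain_value nu t s A <= gain_value nu t s (Ahat t s);
  Ahat_tie : forall t s j, (0 < t <= T)%N -> j \in Ahat t s ->
    bid_cost nu t j s <= rew I j }.

Definition bid_price_policy (Ahat : nat -> S -> {set 'I_n}) : policy :=
  fun h s => [set j in Ahat (size h).+1 s | available h j]%SET.

Lemma phi_antimono s (A B : {set 'I_n}) j : substitutable -> A \in feasible I ->
  B \subset A -> j \in B -> phi I (Some j) A s <= phi I (Some j) B s.
Proof.
move=> [antiI downI] FA sBA jB; have [k] := ubnP #|A :\: B|%SET.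
elim: k B sBA jB => // k IHk B sBA jB; rewrite ltnS => leABk.
have [/eqP | [x]] := set_0Vmem (A :\: B)%SET.
  by rewrite finset.setD_eq0 => sAB; have -> : A = B by apply/eqP; rewrite finset.eqEsubset sAB.
rewrite !inE => /andP[xB xA]; apply: le_trans (antiI s B j x _ jB xB); last first.
  exact: downI FA sBA.
apply: IHk; first by rewrite finset.subUset finset.sub1set xA.
  by rewrite !inE jB orbT.
apply: leq_trans leABk; apply: proper_card; apply/properP; split.
  by apply: finset.setDS; apply: finset.subsetUr.
by exists x; rewrite !inE ?eqxx ?xA ?xB.
Qed.

Lemma exists_maximizer nu t s : well_formed -> substitutable ->
  exists A : {set 'I_n}, [/\ A \in feasible I,
    forall B, B \in feasible I -> gain_value nu t s B <= gain_value nu t s A &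
    forall j, j \in A -> bid_cost nu t j s <= rew I j].
Proof.
move=> wfI subI; have [A0 FA0 maxA0] :=
  arg_maxP (gain_value nu t s) (feasible0 wfI).
pose A := [set j in A0 | bid_cost nu t j s <= rew I j]%SET.
have sAA0 : A \subset A0 by apply/fintype.subsetP => j; rewrite inE => /andP[].
exists A; split; first exact: subI.2 FA0 sAA0.
  move=> B /maxA0 /le_trans; apply; rewrite /gain_value.
  rewrite (bigID (mem A)) /= [X in _ + X]big1 ?addr0 => [|j /andP[jA0]]; last first.
    rewrite inE jA0 /= -ltNge => lt_j; rewrite /gain max_r ?mulr0 //.
    by rewrite subr_le0 ltW.
  rewrite (eq_bigl (mem A)) => [|j /=]; last first.
    by rewrite inE; case: (j \in A0).
  apply: ler_sum => j jA; apply: ler_wpM2r; first by rewrite le_max lexx orbT.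
  exact: phi_antimono.
by move=> j; rewrite inE => /andP[].
Qed.

Lemma exists_bid_prices : well_formed -> substitutable ->
  exists nu Ahat, bid_prices nu Ahat.
Proof.
move=> wfI subI.
suff /(_ T (leqnn T))[nu [Ahat [nu0 H]]] : forall k, (k <= T)%N ->
    exists nu (Ahat : nat -> S -> {set 'I_n}), (forall j s, nu T.+1 j s = 0) /\
    forall t s, (T - k < t <= T)%N ->
      [/\ forall j, nu t j s = \sum_s' trans I t s s' * nu t.+1 j s' +
            (if j \in Ahat t s then phi I (Some j) (Ahat t s) s * gain nu t j s
             else 0),
          Ahat t s \in feasible I,
          forall A, A \in feasible I ->
            gain_value nu t s A <= gain_value nu t s (Ahat t s) &
          forall j, j \in Ahat t s -> bid_cost nu t j s <= rew I j].
  rewrite subnn in H; exists nu, Ahat; split=> // t s.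
  - by move=> j /H - /(_ j)[].
  - by move=> /H - /(_ s)[].
  - by move=> A /H - /(_ s)[_ _ + _]; apply.
  - by move=> j /H - /(_ s)[_ _ _]; apply.
elim=> [_|k IHk ltkT].
  exists (fun _ _ _ => 0), (fun _ _ => finset.set0); split=> // t s.
  by rewrite subn0 => /andP[/leq_trans h /h]; rewrite ltnn.
have [nu [Ahat [nu0 H]]] := IHk (ltnW ltkT).
pose t0 := (T - k)%N.
have [A HA] := choice (fun s => exists_maximizer nu t0 s wfI subI).
pose nu' t j s := if t == t0 then \sum_s' trans I t s s' * nu t.+1 j s' +
  (if j \in A s then phi I (Some j) (A s) s * gain nu t j s else 0)
  else nu t j s.
have cost' t j s : (t0 <= t)%N -> bid_cost nu' t j s = bid_cost nu t j s.
  move=> let0; apply: eq_bigr => s' _; congr (_ * _).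
  apply: eq_bigr => i _; congr (_ * _); apply: eq_bigr => j' _.
  by rewrite /nu' gtn_eqF.
have gain' t j s : (t0 <= t)%N -> gain nu' t j s = gain nu t j s.
  by move=> let0; rewrite /gain cost'.
have value' t s B : (t0 <= t)%N -> gain_value nu' t s B = gain_value nu t s B.
  by move=> let0; apply: eq_bigr => j _; rewrite gain'.
have lt_t t : (t0 <= t)%N -> (t <= T)%N -> t != t0 -> (T - k < t <= T)%N.
  by move=> le0 leT ne; rewrite leT andbT ltn_neqAle eq_sym ne.
exists nu', (fun t s => if t == t0 then A s else Ahat t s); split=> [j s|t s].
  have lt0T : (t0 < T.+1)%N by rewrite ltnS leq_subr.
  by rewrite /nu' (gtn_eqF lt0T).
rewrite subnS prednK ?subn_gt0 // -/t0 => /andP[let0 leT].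
have nuS j s' : nu' t.+1 j s' = nu t.+1 j s' by rewrite /nu' gtn_eqF.
split=> [j||B FB|j].
- rewrite gain' // (eq_bigr _ (fun s' _ => congr1 _ (nuS j s'))) /nu'.
  have [->|ne] := eqVneq t t0; first by [].
  by have [-> ] := H t s (lt_t t let0 leT ne).
- have [_|ne] := eqVneq t t0; first by case: (HA s).
  by have [] := H t s (lt_t t let0 leT ne).
- rewrite !value' //; have [->|ne] := eqVneq t t0.
    by have [_ maxA _] := HA s; apply: maxA.
  by have [_ _ maxA _] := H t s (lt_t t let0 leT ne); apply: maxA.
rewrite cost' //; have [->|ne] := eqVneq t t0.
  by have [_ _ tieA] := HA s; apply: tieA.
by have [_ _ _ tieA] := H t s (lt_t t let0 leT ne); apply: tieA.
Qed.

End Model.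

(* Main.v *)
(* For a stock level c, the function sum_j nu^t_j(s) (w_j + sum_(i in A_j) c_i / C_i) is
   affine in c, and selling a product lowers its expected next value by exactly
   the bid cost of that product.  With w_j = 1 it dominates the value of every
   policy, and at full capacity it is at most (1 + L) sum_j nu^1_j(s).  With
   w_j = 1 - |A_j| it is dominated by the value of the bid price policy, and at
   full capacity it equals sum_j nu^1_j(s).  In the second case the coefficient
   of nu_j is at most 1, and it is nonpositive once some resource of j has run
   out, so the policy loses nothing by withdrawing unavailable products. *)
Require Import Defs.
From mathcomp Require Import all_boot all_order all_algebra.
From mathcomp Require Import boolp classical_sets reals.
Local Open Scope ring_scope.

Import Order.TTheory GRing.Theory Num.Theory.

Set Implicit Arguments.
Unset Strict Implicit.
Unset Printing Implicit Defensive.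

(** * Sums over trajectories as a backward recursion *)

Section TupleSums.
Variables (R : comNzRingType) (X : finType).

Lemma sum_tupleS k (F : k.+1.-tuple X -> R) :
  \sum_(w : k.+1.-tuple X) F w =
  \sum_(x : X) \sum_(w : k.-tuple X) F [tuple of x :: w].
Proof.
rewrite pair_big /=.
rewrite (reindex (fun u : X * k.-tuple X => [tuple of u.1 :: u.2])) //=.
exists (fun w => (thead w, [tuple of behead w])) => [[x w] _|w _] /=.
  by congr (_, _); apply: val_inj.
by rewrite -tuple_eta.
Qed.

Variables (p : seq X -> X -> R) (r : X -> R).

Fixpoint reward_to_go k (h : seq X) : R :=
  if k is k'.+1 then \sum_x p h x * (r x + reward_to_go k' (rcons h x)) else 0.

(* The accumulator [c] makes the induction cover the total mass as well. *)
Lemma sum_trajectories N k h c :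
  (forall h', (size h' < N)%N -> \sum_x p h' x = 1) -> (size h + k <= N)%N ->
  \sum_(w : k.-tuple X)
    (\prod_(t < k) p (h ++ take t w) (tnth w t)) *
      (c + \sum_(t < k) r (tnth w t)) = c + reward_to_go k h.
Proof.
move=> p1; elim: k h c => [|k IHk] h c leN.
  rewrite (big_pred1 [tuple]) => [|w]; first by rewrite !big_ord0 mul1r.
  by rewrite (tuple0 w) /= eqxx.
(* Multiplying [c] by the mass 1 of the next step turns both sides into sums over the first entry
   [x]; the accumulator then becomes [c + r x]. *)
rewrite sum_tupleS /= -[X in _ = X + _]mulr1 -[X in _ = _ * X + _](p1 h) ?mulr_sumr; last first.
  by rewrite (leq_trans _ leN) // addnS ltnS leq_addr.
rewrite -big_split /=; apply: eq_bigr => x _.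
rewrite [c * _]mulrC -mulrDr addrA -IHk; last by rewrite size_rcons addSnnS.
rewrite mulr_sumr; apply: eq_bigr => w _.
rewrite !big_ord_recl tnth0 /= cats0 -!mulrA addrA; congr (_ * (_ * (_ + _))).
  by apply: eq_bigr => t _; rewrite -cat_rcons tnthS.
by apply: eq_bigr => t _; rewrite tnthS.
Qed.

End TupleSums.

Lemma sum_option (R : nmodType) (J : finType) (F : option J -> R) :
  \sum_x F x = F None + \sum_j F (Some j).
Proof.
rewrite (bigD1 None) //=; congr (_ + _).
rewrite (reindex_omap Some id) //=; last by case.
by apply: eq_bigl => j; rewrite eqxx.
Qed.

(** * Expected reward as a reward-to-go, and one-step comparison *)

Section Model.
Variables (R : realType) (m n : nat) (S : finType) (I : instance R m n S).
Hypothesis wfI : well_formed I.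
Local Notation T := (horizon I).

Lemma state_prob_ge0 h s : (size h < T)%N -> 0 <= state_prob I h s.
Proof. by case: h => [|x h] ltT; [apply: init_ge0 | apply: trans_ge0]. Qed.

Lemma state_prob_sum1 h : (size h < T)%N -> \sum_s state_prob I h s = 1.
Proof. by case: h => [|x h] /= ltT; rewrite ?(init_sum1 wfI) ?(trans_sum1 wfI). Qed.

Lemma state_prob_rcons h x s :
  state_prob I (rcons h x) s = trans I (size h).+1 x.1 s.
Proof. by case: h => [|y h] //=; rewrite size_rcons last_rcons. Qed.

Lemma remaining_rcons h x :
  remaining I (rcons h x) = fun i => (remaining I h i - consumption I i x.2)%N.
Proof. by apply/funext => i; rewrite /remaining big_rcons subnDA. Qed.

Lemma choice_prob_ge0 A s x : A \in feasible I -> 0 <= choice_prob I A s x.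
Proof.
move=> FA; case: x => [j|] /=; last exact: phi_null_ge0.
by case: ifP => // jA; apply: phi_ge0.
Qed.

Lemma sum_choice_prob A s F :
  \sum_x choice_prob I A s x * F x =
  phi I None A s * F None + \sum_(j in A) phi I (Some j) A s * F (Some j).
Proof.
rewrite sum_option big_mkcond /=; congr (_ + _).
by rewrite [RHS]big_mkcond; apply: eq_bigr => j _; case: ifP => _; rewrite ?mul0r.
Qed.

Lemma choice_prob_sum1 A s : A \in feasible I -> \sum_x choice_prob I A s x = 1.
Proof.
move=> FA; rewrite -(phi_sum1 wfI s FA).
under eq_bigr do rewrite -[choice_prob _ _ _ _]mulr1.
by rewrite sum_choice_prob mulr1; congr (_ + _); apply: eq_bigr => j _; rewrite mulr1.
Qed.

Definition step_prob (pi : policy n S) (h : history n S) (x : S * option 'I_n) : R :=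
  state_prob I h x.1 * choice_prob I (pi h x.1) x.1 x.2.

Definition value (pi : policy n S) : nat -> history n S -> R :=
  reward_to_go (step_prob pi) (fun x => reward I x.2).

Lemma valueS pi k h : value pi k.+1 h = \sum_s state_prob I h s *
  \sum_x choice_prob I (pi h s) s x * (reward I x + value pi k (rcons h (s, x))).
Proof.
under [RHS]eq_bigr do rewrite mulr_sumr.
by rewrite pair_big; apply: eq_bigr => [[s x]] _; rewrite mulrA.
Qed.

Section Policy.
Variable pi : policy n S.
(** Limited to histories shorter than [T] because [Ahat_feasible] says nothing beyond period [T]. *)
Hypothesis Fpi : forall h s, (size h < T)%N -> pi h s \in feasible I.

Lemma expected_rewardE : expected_reward I pi = value pi T [::].
Proof.
have p1 h : (size h < T)%N -> \sum_x step_prob pi h x = 1.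
  move=> ltT; rewrite -(state_prob_sum1 ltT).
  transitivity (\sum_s \sum_x step_prob pi h (s, x)).
    by rewrite pair_big; apply: eq_bigr => [[]].
  apply: eq_bigr => s _; rewrite /step_prob /= -mulr_sumr choice_prob_sum1 ?mulr1 //.
  exact: Fpi.
rewrite -[RHS]add0r -(sum_trajectories _ _ p1) //.
by apply: eq_bigr => w _; rewrite add0r.
Qed.

(* Taken with [e = 1] for upper bounds and with [e = -1] for lower bounds. *)
Lemma value_le (e : R) (V : history n S -> S -> R) :
  (forall h s, size h = T -> V h s = 0) ->
  (forall h s, (size h < T)%N ->
    \sum_x choice_prob I (pi h s) s x * (e * reward I x +
      \sum_s' trans I (size h).+1 s s' * V (rcons h (s, x)) s') <= V h s) ->
  forall k h, (size h + k)%N = T ->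
    e * value pi k h <= \sum_s state_prob I h s * V h s.
Proof.
move=> VT stepV; elim=> [|k IHk] h.
  rewrite addn0 => hT; rewrite mulr0 big1 // => s _.
  by rewrite VT ?mulr0.
move=> hkT; have ltT : (size h < T)%N by rewrite -hkT addnS ltnS leq_addr.
rewrite valueS mulr_sumr; apply: ler_sum => s _.
rewrite mulrCA ler_wpM2l ?state_prob_ge0 //.
apply: le_trans (stepV h s ltT); rewrite mulr_sumr; apply: ler_sum => x _.
rewrite mulrCA ler_wpM2l ?choice_prob_ge0 ?Fpi // mulrDr lerD2l.
under eq_bigr do rewrite -(state_prob_rcons h (s, x)).
by apply: IHk; rewrite size_rcons addSnnS.
Qed.

End Policy.

(** * Potentials built from bid prices, and their one-step inequalities *)

Section BidPrices.
Hypothesis subI : substitutable I.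
Variables (nu : nat -> 'I_n -> S -> R) (Ahat : nat -> S -> {set 'I_n}).
Hypothesis bidI : bid_prices I nu Ahat.

Definition fill (c : 'I_m -> nat) (j : 'I_n) : R :=
  \sum_(i | uses I i j) (c i)%:R / (cap I i)%:R.

Definition potential (w : 'I_n -> R) t c s : R :=
  \sum_j nu t j s * (w j + fill c j).

Lemma fill_ge0 c j : 0 <= fill c j.
Proof. by apply: sumr_ge0 => i _; apply: divr_ge0. Qed.

Lemma gain_ge0 t j s : 0 <= gain I nu t j s.
Proof. by rewrite /gain le_max lexx orbT. Qed.

Lemma Ahat_phi_gain_ge0 t j s : (0 < t <= T)%N -> j \in Ahat t s ->
  0 <= phi I (Some j) (Ahat t s) s * gain I nu t j s.
Proof.
move=> tT jA; rewrite mulr_ge0 ?gain_ge0 //.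
by apply: (phi_ge0 wfI); first exact: (Ahat_feasible bidI).
Qed.

Lemma nu_ge0 t j s : (0 < t <= T.+1)%N -> 0 <= nu t j s.
Proof.
case/andP=> t0 leT; have [k] := ubnP (T.+1 - t).
elim: k t t0 leT j s => // k IHk t t0 leT j s ltk.
have [->|neT] := eqVneq t T.+1; first by rewrite (nu_end bidI).
have leT' : (t <= T)%N by rewrite -ltnS ltn_neqAle neT.
have tT : (0 < t <= T)%N by rewrite t0.
rewrite (nu_step bidI) // addr_ge0 //; last first.
  by case: ifP => // jA; apply: Ahat_phi_gain_ge0.
(* [trans I T] may have any sign; at [t = T] the zero terminal price removes it. *)
apply: sumr_ge0 => s' _; have [->|neT'] := eqVneq t T.
  by rewrite (nu_end bidI) mulr0.
have ltT : (t < T)%N by rewrite ltn_neqAle neT'.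
rewrite mulr_ge0 ?(trans_ge0 wfI) ?t0 //.
by apply: IHk => //; rewrite subSS -ltnS -subSn.
Qed.

(** Chosen so that [base_weight j + fill c j] is one minus the sum, over the resources of [j], of
    the depleted fractions [1 - c i / cap I i]. *)
Definition base_weight (j : 'I_n) : R := 1 - \sum_(i < m | uses I i j) 1.

Lemma potential_end w c s : potential w T.+1 c s = 0.
Proof. by rewrite /potential big1 // => j _; rewrite (nu_end bidI) mul0r. Qed.

Lemma potential_rec w t c s : (0 < t <= T)%N ->
  potential w t c s = \sum_s' trans I t s s' * potential w t.+1 c s' +
    \sum_(j in Ahat t s) phi I (Some j) (Ahat t s) s * gain I nu t j s *
      (w j + fill c j).
Proof.
move=> tT; under [X in _ = X + _]eq_bigr do rewrite mulr_sumr.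
rewrite exchange_big [X in _ = _ + X]big_mkcond -big_split /=.
apply: eq_bigr => j _; rewrite (nu_step bidI) // mulrDl; congr (_ + _).
  by rewrite mulr_suml; apply: eq_bigr => s' _; rewrite mulrA.
by case: ifP => _; rewrite ?mul0r.
Qed.

(** One unit of resource [i] lowers [fill] by [1 / cap I i] for every product using [i]; exchanging
    the sums groups this loss by resource. The stock hypothesis keeps the natural subtraction
    exact. *)
Lemma potential_consume w t c s j : (forall i, uses I i j <= c i)%N ->
  potential w t (fun i => c i - uses I i j)%N s = potential w t c s -
    \sum_(i | uses I i j) (cap I i)%:R^-1 * \sum_(j' | uses I i j') nu t j' s.
Proof.
move=> le_c.
have fillB j' : fill (fun i => c i - uses I i j)%N j' = fill c j' -
    \sum_(i | uses I i j') (uses I i j)%:R / (cap I i)%:R.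
  by rewrite -sumrB; apply: eq_bigr => i _; rewrite natrB // mulrBl.
rewrite /potential; under eq_bigr do rewrite fillB addrA mulrBr.
rewrite sumrB; congr (_ - _).
under eq_bigr do rewrite mulr_sumr big_mkcond.
rewrite exchange_big [RHS]big_mkcond; apply: eq_bigr => i _ /=.
case: (uses I i j); last by apply: big1 => j' _; rewrite mul0r mulr0 if_same.
rewrite mulr_sumr [RHS]big_mkcond; apply: eq_bigr => j' _.
by rewrite mul1r mulrC.
Qed.

(* The bid cost of a sale is exactly the expected potential it destroys. *)
Lemma potential_offer w t c s (A : {set 'I_n}) : A \in feasible I ->
  (forall j, j \in A -> forall i, uses I i j <= c i)%N ->
  \sum_x choice_prob I A s x * (reward I x + \sum_s' trans I t s s' *
      potential w t.+1 (fun i => c i - consumption I i x)%N s') =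
  \sum_s' trans I t s s' * potential w t.+1 c s' +
    \sum_(j in A) phi I (Some j) A s * (rew I j - bid_cost I nu t j s).
Proof.
move=> FA le_c; rewrite sum_choice_prob /= add0r.
have -> : (fun i => c i - 0)%N = c by apply/funext => i; rewrite subn0.
set E := \sum_s' _ * potential _ _ c _.
(* Total choice probability 1 spreads [E] over the null choice and the products of [A], which are
   then compared term by term. *)
rewrite -[E in RHS]mul1r -(phi_sum1 wfI s FA) mulrDl -addrA mulr_suml.
rewrite -big_split /=; congr (_ + _); apply: eq_bigr => j jA.
rewrite -mulrDr; congr (_ * _); rewrite addrCA; congr (_ + _).
rewrite /bid_cost -sumrB; apply: eq_bigr => s' _.
by rewrite -mulrBr potential_consume //; apply: le_c.
Qed.

(** Net rewards are at most gains, [Ahat] maximizes the total gain over feasible assortments, and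
    each weight [1 + fill c j] is at least 1. *)
Lemma potential_offer_le t c s (A : {set 'I_n}) : (0 < t <= T)%N ->
  A \in feasible I -> (forall j, j \in A -> forall i, uses I i j <= c i)%N ->
  \sum_x choice_prob I A s x * (reward I x + \sum_s' trans I t s s' *
      potential (fun=> 1) t.+1 (fun i => c i - consumption I i x)%N s')
  <= potential (fun=> 1) t c s.
Proof.
move=> tT FA le_c; rewrite potential_offer // potential_rec // lerD2l.
apply: (@le_trans _ _ (gain_value I nu t s A)).
  apply: ler_sum => j jA; rewrite ler_wpM2l ?(phi_ge0 wfI) //.
  by rewrite le_max lexx.
apply: le_trans (Ahat_max bidI s tT FA) _; apply: ler_sum => j jA.
by rewrite ler_peMr ?Ahat_phi_gain_ge0 // lerDl fill_ge0.
Qed.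

(** [Ahat t s] splits into kept and withdrawn products. Withdrawn ones contribute at most 0 to the
    potential; kept ones have weight at most 1 and, by substitutability, are chosen at least as
    often from the smaller [A]. *)
Lemma le_potential_offer t c s (A : {set 'I_n}) : (0 < t <= T)%N ->
  (forall i, c i <= cap I i)%N ->
  A = [set j in Ahat t s | [forall i, uses I i j <= c i]%N]%SET ->
  potential base_weight t c s <= \sum_x choice_prob I A s x *
    (reward I x + \sum_s' trans I t s s' *
      potential base_weight t.+1 (fun i => c i - consumption I i x)%N s').
Proof.
move=> tT le_cap defA.
have sAAhat : A \subset Ahat t s.
  by apply/fintype.subsetP => j; rewrite defA inE => /andP[].
have FAhat := Ahat_feasible bidI s tT.
have FA : A \in feasible I := subI.2 _ _ FAhat sAAhat.
have capi_gt0 i : 0 < (cap I i)%:R :> R by rewrite ltr0n (cap_gt0 wfI).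
rewrite potential_offer //; last first.
  by move=> j; rewrite defA inE => /andP[_ /forallP].
have wE j : base_weight j + fill c j =
    1 - \sum_(i | uses I i j) (1 - (c i)%:R / (cap I i)%:R).
  by rewrite /base_weight /fill sumrB opprB -addrA [- _ + _]addrC.
have slack_ge0 i : 0 <= 1 - (c i)%:R / (cap I i)%:R :> R.
  by rewrite subr_ge0 ler_pdivrMr // mul1r ler_nat.
rewrite potential_rec // lerD2l [leLHS](bigID (mem A)) /= -[leRHS]addr0.
apply: lerD; last first.
  apply: sumr_le0 => j /andP[jAhat jA].
  rewrite mulr_ge0_le0 ?Ahat_phi_gain_ge0 // wE subr_le0.
  move: jA; rewrite defA inE jAhat /= => /forallPn[i].
  case uij: (uses I i j) => //=; rewrite lt0n negbK => /eqP ci0.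
  (* The exhausted resource [i] alone contributes 1 to the depletion, so the weight is
     nonpositive. *)
  by rewrite (bigD1 i) //= ci0 mul0r subr0 lerDl sumr_ge0.
rewrite (eq_bigl (mem A)) => [|j /=]; last first.
  by have [/(fintype.subsetP sAAhat) ->|_] := boolP (j \in A); rewrite ?andbF.
apply: ler_sum => j jA; have jAhat := fintype.subsetP sAAhat j jA.
(* The tie-breaking clause makes the truncation in [gain] inactive; without it only [<=] would
   hold. *)
have -> : rew I j - bid_cost I nu t j s = gain I nu t j s.
  by rewrite /gain max_l // subr_ge0 (Ahat_tie bidI).
apply: (@le_trans _ _ (phi I (Some j) (Ahat t s) s * gain I nu t j s)).
  by rewrite ler_piMr ?Ahat_phi_gain_ge0 // wE gerBl sumr_ge0.
by rewrite ler_wpM2r ?gain_ge0 // phi_antimono.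
Qed.

(** * Potentials at full capacity and the two global bounds *)

Lemma fill_cap j : fill (cap I) j = (\sum_(i < m) uses I i j)%:R.
Proof.
rewrite natr_sum /fill big_mkcond; apply: eq_bigr => i _.
by case: ifP => // _; rewrite divff // pnatr_eq0 -lt0n (cap_gt0 wfI).
Qed.

Lemma remaining_nil : remaining I [::] = cap I.
Proof. by apply/funext => i; rewrite /remaining big_nil subn0. Qed.

(** The pivot between the two policies: an optimal one earns at most [1 + max_use I] times it, the
    bid price policy at least it. *)
Definition total_price : R := \sum_s init I s * \sum_j nu 1 j s.

Lemma expected_reward_le pi : feasible_policy I pi ->
  expected_reward I pi <= (1 + (max_use I)%:R) * total_price.
Proof.
move=> Fpi; have FpiT h s : (size h < T)%N -> pi h s \in feasible I.
  by move=> _; case: (Fpi h s).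
(* After history [h], the period about to be played is [(size h).+1]. *)
pose V h s := potential (fun=> 1) (size h).+1 (remaining I h) s.
rewrite expected_rewardE // -[leLHS]mul1r.
apply: le_trans (value_le FpiT (V := V) _ _ _) _ => //.
- by move=> h s hT; rewrite /V hT potential_end.
- move=> h s hT; have [FA avA] := Fpi h s.
  under eq_bigr do rewrite mul1r /V size_rcons remaining_rcons /=.
  by apply: potential_offer_le => // j /avA /forallP.
rewrite /total_price mulr_sumr; apply: ler_sum => s _; rewrite mulrCA.
rewrite ler_wpM2l ?(init_ge0 wfI) // /V remaining_nil mulr_sumr.
apply: ler_sum => j _; rewrite mulrC ler_wpM2r ?nu_ge0 //.
by rewrite lerD2l fill_cap ler_nat (leq_bigmax j).
Qed.

Lemma le_expected_reward_bid_price :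
  total_price <= expected_reward I (bid_price_policy I Ahat).
Proof.
set pi := bid_price_policy I Ahat.
have FpiT h s : (size h < T)%N -> pi h s \in feasible I.
  move=> hT; apply: (subI.2 _ _ (Ahat_feasible bidI (t := (size h).+1) s hT)).
  by apply/fintype.subsetP => j; rewrite inE => /andP[].
(* Negated to match [value_le] at [e = -1]. *)
pose V h s := - potential base_weight (size h).+1 (remaining I h) s.
rewrite expected_rewardE // -lerN2 -mulN1r.
apply: le_trans (value_le FpiT (V := V) _ _ _) _ => //.
- by move=> h s hT; rewrite /V hT potential_end oppr0.
- move=> h s hT; rewrite lerNr -sumrN.
  apply: le_trans (le_potential_offer (A := pi h s) _ _ _) _ => //.
    by move=> i; apply: leq_subr.
  apply: ler_sum => x _; rewrite -mulrN mulN1r opprD opprK -sumrN.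
  rewrite /V size_rcons remaining_rcons /=.
  by under [X in _ <= _ * (_ + X)]eq_bigr do rewrite mulrN opprK.
rewrite /total_price -sumrN; apply: ler_sum => s _.
rewrite mulrN lerN2 /V remaining_nil ler_wpM2l ?(init_ge0 wfI) //.
(* At full stock nothing is depleted, so the weight of each price is exactly 1. *)
apply: ler_sum => j _; rewrite fill_cap natr_sum /base_weight.
rewrite [X in _ - X]big_mkcond /=.
rewrite [X in _ - X + _](eq_bigr (fun i => (uses I i j)%:R)) ?subrK ?mulr1 //.
by move=> i _; case: ifP.
Qed.

End BidPrices.
End Model.

Theorem theorem2 (R : realType) (m n : nat) (S : finType)
    (I : instance R m n S) (wfI : well_formed I) (subI : substitutable I)
    (nu : nat -> 'I_n -> S -> R) (Ahat : nat -> S -> {set 'I_n})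
    (bidI : bid_prices I nu Ahat) :
  expected_reward I (bid_price_policy I Ahat) >=
    1 / (1 + (max_use I)%:R) * OPT I.
Proof.
have [pi [Fpi <- _]] := OPT_attained wfI.
apply: le_trans (le_expected_reward_bid_price wfI subI bidI).
rewrite mul1r mulrC ler_pdivrMr ?ltr_pwDl // mulrC.
exact: (expected_reward_le wfI bidI).
Qed.
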